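(* Let $Q$ be a differentially closed quasifield. There is a contravariant equivalence between the category of quasireduced differentially finitely generated algebras over $Q$ (with differential $Q$-algebra homomorphisms) and the category of quasivarieties over $Q$ (with regular mappings).
   Context: A differential ring is a commutative associative unital ring with a fixed finite set $\Delta$ of pairwise commuting derivations (the same $\Delta$ for all rings). $\Theta$ is the free commutative monoid generated by $\Delta$, acting as derivative operators. All rings have nonzero characteristic; homomorphisms are unital, and differential homomorphisms commute with $\Delta$. A quasifield is a nonzero differential ring of nonzero characteristic whose only differential ideals are $0$ and the whole ring. $Q\{y_1,\ldots,y_n\}$ is the polynomial ring over $Q$ in the $\theta y_i$ ($\theta\in\Theta$, $1\le i\le n$) with the obvious derivations. For $E\subseteq Q\{y_1,\ldots,y_n\}$, $V(E)\subseteq Q^n$ is the set of common zeros of $E$; for $X\subseteq Q^n$, $I(X)$ is the set of differential polynomials vanishing on $X$. For a differential ideal $\mathfrak a$, $\mathfrak{rad}(\mathfrak a)=\{f\mid\theta f\text{ is nilpotent modulo }\mathfrak a\text{ for all }\theta\in\Theta\}$. $Q$ is differentially closed if $\mathfrak{rad}(\mathfrak a)=I(V(\mathfrak a))$ for every $n$ and every differential ideal $\mathfrak a$ of $Q\{y_1,\ldots,y_n\}$. A differential ring is quasireduced if its only element $x$ such that $\theta x$ is nilpotent for all $\theta\in\Theta$ is $x=0$. A differential $Q$-algebra is differentially finitely generated if it is generated as a $Q$-algebra by the derivatives $\theta b_1,\ldots,\theta b_n$ ($\theta\in\Theta$) of finitely many elements. A quasivariety over $Q$ is a subset $X\subseteq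 Q^n$ (for some $n$) of the form $V(E)$ with $E\subseteq Q\{y_1,\ldots,y_n\}$. For quasivarieties $X\subseteq Q^n$, $Y\subseteq Q^m$, a mapping $\varphi\colon X\to Y$ is regular if there are differential polynomials $\varphi_1,\ldots,\varphi_m\in Q\{x_1,\ldots,x_n\}$ such that $\varphi(x)=(\varphi_1(x),\ldots,\varphi_m(x))$ for all $x\in X$. *)

(* Defs.v *)
From HB Require Import structures.
From mathcomp Require Import all_boot all_order all_algebra finmap ring.
From mathcomp Require Import boolp classical_sets.
From mathcomp.multinomials Require Import monalg.

Set Implicit Arguments.
Unset Strict Implicit.
Unset Printing Implicit Defensive.

Import GRing.Theory.

Local Open Scope ring_scope.

(* The ring may be zero here: the zero algebra is quasireduced, and it
   corresponds to the empty quasivariety. *)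
HB.mixin Record isDifferential (Delta : finType) R of GRing.ComPzRing R := {
  der : Delta -> R -> R;
  derD : forall d, {morph der d : x y / x + y};
  derM : forall d x y, der d (x * y) = der d x * y + x * der d y;
  derC : forall d e x, der d (der e x) = der e (der d x)
}.

#[short(type="diffRingType")]
HB.structure Definition DiffRing (Delta : finType) :=
  {R of GRing.ComPzRing R & isDifferential Delta R}.

#[short(type="diffNzRingType")]
HB.structure Definition DiffNzRing (Delta : finType) :=
  {R of GRing.ComNzRing R & isDifferential Delta R}.

(* The monoid Theta of derivative operators is [{cmonom Delta}]. *)
Section Theta.
Variables (Delta : finType) (R : diffRingType Delta).
Implicit Types (t : {cmonom Delta}) (x : R).

(* The derivations commute, so the order of [enum Delta] is irrelevant. *)
Definition theta t x : R :=
  foldr (fun d y => iter (t d) (der d) y) x (enum Delta).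

Lemma der_iter d e k x : der d (iter k (der e) x) = iter k (der e) (der d x).
Proof. by elim: k => //= k <-; rewrite derC. Qed.

Lemma theta_der e t x : theta (mmul (ucm e) t) x = der e (theta t x).
Proof.
rewrite /theta.
have H (s : seq Delta) : uniq s ->
  foldr (fun d y => iter (mmul (ucm e) t d) (der d) y) x s =
  if e \in s then der e (foldr (fun d y => iter (t d) (der d) y) x s)
  else foldr (fun d y => iter (t d) (der d) y) x s.
  elim: s => //= d s IH /andP[ds us]; rewrite IH // inE cmM cmU.
  case: (eqVneq e d) => [->|ne] /=; first by rewrite (negbTE ds).
  by rewrite add0n; case: ifP => // _; rewrite der_iter.
by rewrite H ?enum_uniq // mem_enum.
Qed.

Lemma theta1 x : theta mone x = x.
Proof. by rewrite /theta; elim: (enum Delta) => //= d s ->; rewrite cm1. Qed.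

End Theta.

Lemma theta_morph (Delta : finType) (R S : diffRingType Delta) (g : R -> S) :
  (forall d, {morph g : x / der d x}) ->
  forall t x, g (theta t x) = theta t (g x).
Proof.
move=> gd t x; rewrite /theta; elim: (enum Delta) => //= d s <-.
by elim: (t d) => //= k IH; rewrite gd IH.
Qed.

Section Monomials.
Variables (R : comNzRingType) (V : choiceType).
Implicit Types (m : {cmonom V}).

Lemma malgUM (c c' : R) m m' :
  (<< c *g m >> : {malg R[cmonom V]}) * << c' *g m' >> = << c * c' *g mmul m m' >>.
Proof. exact: fgmulUU. Qed.

Lemma malgUE (c : R) m : << c *g m >> = c%:MP * << m >> :> {malg R[cmonom V]}.
Proof. by rewrite malgUM mulr1 mul1m. Qed.

Lemma malgUU m m' : << mmul m m' >> = << m >> * << m' >> :> {malg R[cmonom V]}.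
Proof. by rewrite malgUM mulr1. Qed.

Lemma malg_ind (P : {malg R[cmonom V]} -> Prop) :
  P 0 -> (forall p q, P p -> P q -> P (p + q)) ->
  (forall c m, P << c *g m >>) -> forall p, P p.
Proof. by move=> P0 PD PU p; rewrite [p]monalgE; apply: big_ind. Qed.

Lemma monom_ind (P : cmonom V -> Prop) :
  P mone -> (forall v m, P m -> P (mmul (ucm v) m)) -> forall m, P m.
Proof.
move=> P1 PM m; have [k] := ubnP (mdeg m); elim: k m => // k IH m lemk.
have [->//|m1] := eqVneq m mone.
have [v mv] : exists v, v \in finsupp m.
  apply/fset0Pn; apply: contra_neq m1 => m0; apply/eqP/cmP => v.
  by apply/eqP; rewrite cm1 cmE_eq0 m0.
have mE : m = mmul (ucm v) (divcm m (ucm v)).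
  apply/eqP/cmP => w; rewrite cmM divcmE cmU subnKC //.
  by case: eqVneq => // <-; rewrite lt0n cmE_neq0.
rewrite mE; apply/PM/IH; apply: (@leq_trans (mdeg m)); last by rewrite -ltnS.
by rewrite [X in (_ < mdeg X)%N]mE mdegM mdegU.
Qed.

Lemma malg_gen_ind (P : {malg R[cmonom V]} -> Prop) :
  (forall c : R, P c%:MP) -> (forall v, P << ucm v >>) ->
  (forall p q, P p -> P q -> P (p + q)) ->
  (forall p q, P p -> P q -> P (p * q)) -> forall p, P p.
Proof.
move=> PC PX PD PM; apply: malg_ind => [||c m] //.
  by rewrite -malgC0E; exact: PC.
rewrite malgUE; apply: (PM); first exact: PC.
elim/monom_ind: m => [|v m IH]; first exact: PC.
rewrite (malgUU (ucm v) m); exact: PM (PX v) IH.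
Qed.

End Monomials.

(* Stated over an abstract ring because unification is very slow on the
   concrete operations of monoid algebras. *)
Section Leibniz.
Variables (S : comPzRingType) (D E : S -> S).
Hypotheses (DD : {morph D : x y / x + y}) (ED : {morph E : x y / x + y}).

Let leibniz x y := D (x * y) = D x * y + x * D y.

Lemma leibnizDl x y z : leibniz x z -> leibniz y z -> leibniz (x + y) z.
Proof. by rewrite /leibniz mulrDl !DD => -> ->; rewrite !mulrDl addrACA. Qed.

Lemma leibnizDr x y z : leibniz z x -> leibniz z y -> leibniz z (x + y).
Proof. by rewrite /leibniz mulrDr !DD => -> ->; rewrite !mulrDr addrACA. Qed.

Lemma leibniz0l x : D 0 = 0 -> leibniz 0 x.
Proof. by rewrite /leibniz !mul0r => ->; rewrite mul0r addr0. Qed.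

Lemma leibniz0r x : D 0 = 0 -> leibniz x 0.
Proof. by rewrite /leibniz !mulr0 => ->; rewrite mulr0 addr0. Qed.

Lemma leibniz_term c c' x x' cx cx' dc dc' dx dx' :
  cx = c * x -> cx' = c' * x' ->
  D cx = dc * x + c * dx -> D cx' = dc' * x' + c' * dx' ->
  D (cx * cx') =
    (dc * c' + c * dc') * (x * x') + (c * c') * (dx * x' + x * dx') ->
  leibniz cx cx'.
Proof. by rewrite /leibniz => -> -> -> -> ->; ring. Qed.

Hypotheses (DM : forall x y, D (x * y) = D x * y + x * D y)
           (EM : forall x y, E (x * y) = E x * y + x * E y).

Lemma der_commM x y :
  D (E x) = E (D x) -> D (E y) = E (D y) -> D (E (x * y)) = E (D (x * y)).
Proof. by move=> hx hy; rewrite EM DM DD ED !DM !EM hx hy; ring. Qed.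

Lemma der_commD x y :
  D (E x) = E (D x) -> D (E y) = E (D y) -> D (E (x + y)) = E (D (x + y)).
Proof. by move=> hx hy; rewrite ED !DD ED hx hy. Qed.

End Leibniz.

(* The derivation of the polynomial ring over [R] in the indeterminates [V]
   which acts as [delta] on [R] and sends the indeterminate [v] to [shift v]. *)
HB.lock Definition der_monom (R : comNzRingType) (V : choiceType)
    (shift : V -> V) (m : {cmonom V}) : {malg R[cmonom V]} :=
  \sum_(v <- finsupp m) << mmul (divcm m (ucm v)) (ucm (shift v)) >> *+ m v.

HB.lock Definition der_malg (R : comNzRingType) (V : choiceType)
    (delta : R -> R) (shift : V -> V) (p : {malg R[cmonom V]}) :
    {malg R[cmonom V]} :=
  \sum_(m <- msupp p)
    (<< delta p@_m *g m >> + (p@_m)%:MP * der_monom R shift m).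

Section PolynomialDerivation.
Variables (R : comNzRingType) (V : choiceType) (delta : R -> R) (shift : V -> V).

Implicit Types (m : {cmonom V}) (v : V) (p q : {malg R[cmonom V]}).

Local Notation der_monom := (der_monom R shift).
Local Notation der_malg := (der_malg delta shift).

Hypotheses (deltaD : {morph delta : x y / x + y})
           (deltaM : forall x y, delta (x * y) = delta x * y + x * delta y).

Let delta0 : delta 0 = 0.
Proof. by apply: (@addrI _ (delta 0)); rewrite -deltaD !addr0. Qed.

Let delta1 : delta 1 = 0.
Proof.
apply: (@addrI _ (delta 1)); rewrite addr0.
by have := deltaM 1 1; rewrite !mul1r mulr1 => {1}<-.
Qed.

Lemma der_monomEw m (D : {fset V}) : (finsupp m `<=` D)%fset ->
  der_monom m = \sum_(v <- D)
    << mmul (divcm m (ucm v)) (ucm (shift v)) >> *+ m v.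
Proof.
move=> le; rewrite der_monom.unlock (big_fset_incl _ le) // => v _.
by rewrite -cmE_eq0 => /eqP ->; rewrite mulr0n.
Qed.

Lemma der_monomM m1 m2 :
  der_monom (mmul m1 m2) = der_monom m1 * << m2 >> + << m1 >> * der_monom m2.
Proof.
have le1 := fsubsetUl (finsupp m1) (finsupp m2).
have le2 := fsubsetUr (finsupp m1) (finsupp m2).
rewrite (der_monomEw le1) (der_monomEw le2) der_monom.unlock mdomD.
rewrite mulr_suml mulr_sumr -big_split; apply: eq_bigr => v _ /=.
have H1 : (0 < m1 v)%N -> mmul (divcm (mmul m1 m2) (ucm v)) (ucm (shift v)) =
    mmul (mmul (divcm m1 (ucm v)) (ucm (shift v))) m2.
  move=> m1v; apply/eqP/cmP => u; rewrite !(cmM, divcmE, cmU).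
  case: (eqVneq v u) m1v => [->|_] m1v; first by rewrite -addnBAC // addnAC.
  by rewrite !subn0 addnAC.
have H2 : (0 < m2 v)%N -> mmul (divcm (mmul m1 m2) (ucm v)) (ucm (shift v)) =
    mmul m1 (mmul (divcm m2 (ucm v)) (ucm (shift v))).
  move=> m2v; apply/eqP/cmP => u; rewrite !(cmM, divcmE, cmU).
  case: (eqVneq v u) m2v => [->|_] m2v; first by rewrite -addnBA // addnA.
  by rewrite !subn0 addnA.
rewrite [mmul m1 m2 v]cmM.
move: (m1 v) (m2 v) (mmul (divcm m1 _) _) (mmul (divcm m2 _) _)
  (mmul (divcm (mmul m1 m2) _) _) H1 H2 => a b x y z H1 H2.
rewrite [LHS]mulrnDr mulrnAr [X in _ = X + _]mulrnAl; congr (_ + _).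
  by case: a H1 => [|a ->] //; rewrite malgUU.
by case: b H2 => [|b ->] //; rewrite malgUU.
Qed.

Lemma der_monom1 : der_monom mone = 0.
Proof. by rewrite der_monom.unlock mdom1 big_seq_fset0. Qed.

Lemma der_monomU v : der_monom (ucm v) = << ucm (shift v) >>.
Proof.
rewrite der_monom.unlock mdomU big_seq_fset1 cmUU mulr1n.
congr << _ >>; apply/eqP/cmP => w; by rewrite cmM divcmE subnn.
Qed.

Lemma der_malgEw p (D : {fset cmonom V}) : (msupp p `<=` D)%fset ->
  der_malg p =
  \sum_(m <- D) (<< delta p@_m *g m >> + (p@_m)%:MP * der_monom m).
Proof.
move=> le; rewrite der_malg.unlock (big_fset_incl _ le) // => m _ /mcoeff_outdom ->.
by rewrite delta0 !monalgU0 mul0r addr0.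
Qed.

Lemma der_malgD : {morph der_malg : p q / p + q}.
Proof.
move=> p q; pose D := (msupp p `|` msupp q)%fset.
rewrite (@der_malgEw p D) ?fsubsetUl // (@der_malgEw q D) ?fsubsetUr //.
rewrite (@der_malgEw (p + q) D) ?msuppD_le // -big_split.
apply: eq_bigr => m _; rewrite mcoeffD deltaD !monalgUD mulrDl /=.
by rewrite addrACA.
Qed.

Lemma der_malg0 : der_malg 0 = 0.
Proof. by rewrite der_malg.unlock msupp0 big_seq_fset0. Qed.

Lemma der_malgU c m :
  der_malg << c *g m >> = (delta c)%:MP * << m >> + c%:MP * der_monom m.
Proof.
rewrite (der_malgEw msuppU_le) big_seq_fset1 mcoeffUU.
by rewrite malgUE.
Qed.

Lemma der_malgM p q :
  der_malg (p * q) = der_malg p * q + p * der_malg q.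
Proof.
elim/malg_ind: p => [|p1 p2|c m]; first exact/leibniz0l/der_malg0.
  exact/leibnizDl/der_malgD.
elim/malg_ind: q => [|q1 q2|c' m']; first exact/leibniz0r/der_malg0.
  exact/leibnizDr/der_malgD.
apply: (leibniz_term (malgUE c m) (malgUE c' m') (der_malgU c m)
                     (der_malgU c' m')).
apply: etrans (congr1 der_malg (malgUM c c' m m')) _.
apply: (etrans (der_malgU (c * c') (mmul m m'))).
apply: congr2; apply: congr2.
- rewrite deltaM; apply: etrans (monalgUD _ _ _) _.
  by congr (_ + _); exact: mpolyCM.
- exact: malgUU.
- exact: mpolyCM.
- exact: der_monomM.
Qed.

Lemma der_malgC c : der_malg c%:MP = (delta c)%:MP.
Proof.
apply: (etrans (der_malgU c mone)); rewrite der_monom1 [X in _ + X]mulr0 addr0.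
exact: mulr1.
Qed.

Lemma der_malgX v : der_malg << ucm v >> = << ucm (shift v) >>.
Proof.
apply: (etrans (der_malgU 1 (ucm v))); rewrite delta1 malgC0E der_monomU.
by rewrite [X in X + _]mul0r add0r; exact: mul1r.
Qed.

End PolynomialDerivation.

Section Commute.
Variables (R : comNzRingType) (V : choiceType) (d e : R -> R) (s t : V -> V).
Hypotheses (dD : {morph d : x y / x + y})
           (dM : forall x y, d (x * y) = d x * y + x * d y)
           (eD : {morph e : x y / x + y})
           (eM : forall x y, e (x * y) = e x * y + x * e y)
           (deC : forall x, d (e x) = e (d x))
           (stC : forall v, s (t v) = t (s v)).

Lemma der_malg_comm (p : {malg R[cmonom V]}) :
  der_malg d s (der_malg e t p) = der_malg e t (der_malg d s p).
Proof.
have DD := @der_malgD R V d s dD; have ED := @der_malgD R V e t eD.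
have DM := @der_malgM R V d s dD dM; have EM := @der_malgM R V e t eD eM.
have PM := der_commM DD ED DM EM.
have PC x : der_malg d s (der_malg e t x%:MP) = der_malg e t (der_malg d s x%:MP).
  apply: (etrans (congr1 (der_malg d s) (der_malgC t eD x))).
  apply: (etrans (der_malgC s dD (e x))).
  apply: (etrans (congr1 (fun y => y%:MP) (deC x))); symmetry.
  apply: (etrans (congr1 (der_malg e t) (der_malgC s dD x))).
  exact: der_malgC.
have PX v : der_malg d s (der_malg e t << ucm v >>) =
            der_malg e t (der_malg d s << ucm v >>).
  apply: (etrans (congr1 (der_malg d s) (der_malgX t eD eM v))).
  apply: (etrans (der_malgX s dD dM (t v))).
  apply: (etrans (congr1 (fun y => << ucm y >>) (stC v))); symmetry.
  apply: (etrans (congr1 (der_malg e t) (der_malgX s dD dM v))).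
  exact: der_malgX.
exact: malg_gen_ind PC PX (der_commD DD ED) PM p.
Qed.

End Commute.

(* [(t, i)] stands for the indeterminate theta y_i, with theta = t. *)
Definition dpoly (Delta : finType) (Q : diffNzRingType Delta) (n : nat) :=
  {malg Q[cmonom ({cmonom Delta} * 'I_n)%type]}.

Section DifferentialPolynomials.
Variables (Delta : finType) (Q : diffNzRingType Delta) (n : nat).

Definition shift_var (d : Delta) (v : {cmonom Delta} * 'I_n) :=
  (mmul (ucm d) v.1, v.2).

Definition der_dpoly (d : Delta) : dpoly Q n -> dpoly Q n :=
  der_malg (der d) (shift_var d).

Fact der_dpolyD d : {morph der_dpoly d : p q / p + q}.
Proof. exact: der_malgD (derD d). Qed.

Fact der_dpolyM d p q :
  der_dpoly d (p * q) = der_dpoly d p * q + p * der_dpoly d q.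
Proof. exact (@der_malgM _ _ (der d) (shift_var d) (derD d) (derM d) p q). Qed.

Fact der_dpolyC d e p :
  der_dpoly d (der_dpoly e p) = der_dpoly e (der_dpoly d p).
Proof.
apply: der_malg_comm => [||||x|v]; do ?[exact: derD | exact: derM].
  exact: derC.
by rewrite /shift_var !mulmA (mulmC (ucm d)).
Qed.

HB.instance Definition _ :=
  isDifferential.Build Delta {malg Q[cmonom ({cmonom Delta} * 'I_n)%type]}
    der_dpolyD der_dpolyM der_dpolyC.

End DifferentialPolynomials.

Section Evaluation.
Variables (Delta : finType) (Q S : diffNzRingType Delta) (n : nat).

Definition monom_eval (x : 'I_n -> S) (m : cmonom ({cmonom Delta} * 'I_n)%type) : S :=
  \prod_(v <- finsupp m) theta v.1 (x v.2) ^+ m v.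

(* Evaluation at [x], the coefficients being sent to [S] by [f]. *)
Definition deval (f : Q -> S) (x : 'I_n -> S) (p : dpoly Q n) : S :=
  mmap f (monom_eval x) p.

Lemma monom_evalEw (x : 'I_n -> S) (m : cmonom ({cmonom Delta} * 'I_n)%type)
    (D : {fset ({cmonom Delta} * 'I_n)%type}) :
  (finsupp m `<=` D)%fset ->
  monom_eval x m = \prod_(v <- D) theta v.1 (x v.2) ^+ m v.
Proof.
move=> le; rewrite /monom_eval (big_fset_incl _ le) // => v _.
by rewrite -cmE_eq0 => /eqP ->; rewrite expr0.
Qed.

Fact monom_eval_mmorphism (x : 'I_n -> S) : mmorphism (monom_eval x).
Proof.
split=> [m1 m2 /=|]; last by rewrite /monom_eval mdom1 big_seq_fset0.
rewrite (monom_evalEw x (fsubsetUl (finsupp m1) (finsupp m2))).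
rewrite (monom_evalEw x (fsubsetUr (finsupp m1) (finsupp m2))).
rewrite /monom_eval mdomD -big_split.
by apply: eq_bigr => v _; rewrite cmM exprD.
Qed.

HB.instance Definition _ (x : 'I_n -> S) :=
  isMultiplicative.Build _ S (monom_eval x) (monom_eval_mmorphism x).

Variables (f : {rmorphism Q -> S}) (x : 'I_n -> S).

Lemma devalD : {morph deval f x : p q / p + q}.
Proof. exact: mmapD. Qed.

Lemma devalM : {morph deval f x : p q / p * q}.
Proof.
have [H _] := @mmap_is_multiplicative _ _ S f (monom_eval x).
exact: H.
Qed.

Lemma devalC c : deval f x c%:MP = f c.
Proof. exact: mmapC. Qed.

Lemma devalX v : deval f x << ucm v >> = theta v.1 (x v.2).
Proof.
apply: (etrans (mmapU _ _)); rewrite [X in X * _](rmorph1 f) mul1r /monom_eval.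
by rewrite mdomU big_seq_fset1 cmUU expr1.
Qed.

Lemma deval_der : (forall d, {morph f : c / der d c}) ->
  forall d, {morph deval f x : p / der d p}.
Proof.
move=> fd d; apply: malg_gen_ind => [c|v|p q hp hq|p q hp hq].
- apply: (etrans (congr1 (deval f x) (der_malgC _ (derD d) c))).
  apply: (etrans (devalC _)); apply: (etrans (fd d c)).
  exact: congr1 (esym (devalC c)).
- apply: (etrans (congr1 (deval f x) (der_malgX _ (derD d) (derM d) v))).
  apply: (etrans (devalX _)); apply: (etrans (theta_der d v.1 _)).
  exact: congr1 (esym (devalX v)).
- by rewrite derD (devalD (der d p)) hp hq (devalD p) derD.
- apply: (etrans (congr1 (deval f x) (derM d p q))); apply: (etrans (devalD _ _)).
  apply: (etrans (congr2 +%R (devalM _ _) (devalM _ _))); rewrite hp hq.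
  by apply: esym; apply: (etrans (congr1 (der d) (devalM p q))); exact: derM.
Qed.
End Evaluation.

Lemma deval_comp (Delta : finType) (Q : diffNzRingType Delta) (n m : nat)
    (x : 'I_n -> Q) (phi : 'I_m -> dpoly Q n) (p : dpoly Q m) :
  deval idfun x (deval malgC phi p) =
  deval idfun (fun j => deval idfun x (phi j)) p.
Proof.
elim/malg_gen_ind: p => [c|v|p q hp hq|p q hp hq].
- apply: (etrans (congr1 (deval idfun x) (devalC malgC phi c))).
  apply: (etrans (devalC idfun x c)).
  exact: esym (devalC idfun (fun j => deval idfun x (phi j)) c).
- apply: (etrans (congr1 (deval idfun x) (devalX malgC phi v))).
  have dx d : {morph deval idfun x : p / der d p} by apply: deval_der.
  apply: (etrans (theta_morph dx v.1 (phi v.2))).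
  exact: esym (devalX idfun (fun j => deval idfun x (phi j)) v).
- apply: (etrans (congr1 (deval idfun x) (devalD malgC phi p q))).
  apply: (etrans (devalD idfun x _ _)).
  apply: (etrans (congr2 +%R hp hq)).
  exact: esym (devalD idfun (fun j => deval idfun x (phi j)) p q).
- apply: (etrans (congr1 (deval idfun x) (devalM malgC phi p q))).
  apply: (etrans (devalM idfun x _ _)).
  apply: (etrans (congr2 *%R hp hq)).
  exact: esym (devalM idfun (fun j => deval idfun x (phi j)) p q).
Qed.

Section DifferentialAlgebra.
Variable Delta : finType.

Definition nilpotent_mod (R : diffRingType Delta) (I : set R) (x : R) :=
  exists k : nat, I (x ^+ k).

Definition diff_ideal (R : diffRingType Delta) (I : set R) :=
  [/\ I 0,
      forall x y, I x -> I y -> I (x + y),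
      forall a x, I x -> I (a * x) &
      forall d x, I x -> I (der d x)].

Definition rad (R : diffRingType Delta) (I : set R) : set R :=
  [set f | forall t, nilpotent_mod I (theta t f)]%classic.

Definition quasireduced (R : diffRingType Delta) :=
  forall x : R, (forall t, exists k : nat, theta t x ^+ k = 0) -> x = 0.

(* That [Q] is nonzero is part of its type. *)
Definition quasifield (Q : diffNzRingType Delta) :=
  (exists2 p : nat, (0 < p)%N & p%:R = 0 :> Q) /\
  (forall I : set Q, diff_ideal I -> I = [set 0]%classic \/ I = setT).

Variable Q : diffNzRingType Delta.

Definition zeros n (E : set (dpoly Q n)) : set {ffun 'I_n -> Q} :=
  [set x | forall p, E p -> deval idfun x p = 0]%classic.

Definition vanishing n (X : set {ffun 'I_n -> Q}) : set (dpoly Q n) :=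
  [set p | forall x, X x -> deval idfun x p = 0]%classic.

Definition diff_closed :=
  forall n (I : set (dpoly Q n)), diff_ideal I ->
  rad I = vanishing (zeros I).

(* The nonzero characteristic of the rings over [Q] is inherited from [Q]. *)
Record diffAlg := DiffAlg {
  alg_ring :> diffRingType Delta;
  alg_in : {rmorphism Q -> alg_ring};
  alg_in_der : forall d, {morph alg_in : c / der d c}
}.

Definition subalgebra (A : diffAlg) (S : set A) :=
  [/\ forall c, S (alg_in A c),
      forall x y, S x -> S y -> S (x + y) &
      forall x y, S x -> S y -> S (x * y)].

Definition diff_fin_gen (A : diffAlg) :=
  exists (n : nat) (b : 'I_n -> A), forall S : set A,
    subalgebra S -> (forall t i, S (theta t (b i))) -> S = setT.

Definition is_diff_alg_hom (A B : diffAlg) (f : A -> B) :=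
  [/\ {morph f : x y / x + y}, {morph f : x y / x * y}, f 1 = 1,
      forall d, {morph f : x / der d x} &
      forall c, f (alg_in A c) = alg_in B c].

End DifferentialAlgebra.

Record category := Category {
  obj :> Type;
  hom : obj -> obj -> Type;
  cat_id : forall a, hom a a;
  cat_comp : forall a b c, hom b c -> hom a b -> hom a c;
  cat_compm1 : forall a b (f : hom a b), cat_comp f (cat_id a) = f;
  cat_comp1m : forall a b (f : hom a b), cat_comp (cat_id b) f = f;
  cat_compA : forall a b c d (h : hom c d) (g : hom b c) (f : hom a b),
    cat_comp h (cat_comp g f) = cat_comp (cat_comp h g) f
}.

Definition opposite (C : category) : category :=
  @Category C (fun a b => hom b a) (@cat_id C) (fun a b c g f => cat_comp f g)
    (fun a b => @cat_comp1m C b a) (fun a b => @cat_compm1 C b a)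
    (fun a b c d h g f => esym (cat_compA f g h)).

Record functor (C D : category) := Functor {
  functor_obj :> C -> D;
  functor_hom : forall a b, hom a b -> hom (functor_obj a) (functor_obj b);
  functor_hom_id : forall a, functor_hom (cat_id a) = cat_id (functor_obj a);
  functor_hom_comp : forall a b c (g : hom b c) (f : hom a b),
    functor_hom (cat_comp g f) = cat_comp (functor_hom g) (functor_hom f)
}.

Definition functor_id (C : category) : functor C C :=
  @Functor C C (fun a => a) (fun a b f => f) (fun a => erefl)
    (fun a b c g f => erefl).

Definition functor_comp (C D E : category) (G : functor D E) (F : functor C D) :
    functor C E :=
  @Functor C E (fun a => G (F a)) (fun a b f => functor_hom G (functor_hom F f))
    (fun a => etrans (congr1 (@functor_hom _ _ G _ _) (functor_hom_id F a))
                     (functor_hom_id G (F a)))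
    (fun a b c g f =>
       etrans (congr1 (@functor_hom _ _ G _ _) (functor_hom_comp F g f))
              (functor_hom_comp G (functor_hom F g) (functor_hom F f))).

Definition naturally_isomorphic (C D : category) (F G : functor C D) :=
  exists (eta : forall a, hom (F a) (G a)) (eps : forall a, hom (G a) (F a)),
    [/\ forall a b (f : hom a b),
          cat_comp (eta b) (functor_hom F f) = cat_comp (functor_hom G f) (eta a),
        forall a, cat_comp (eps a) (eta a) = cat_id (F a) &
        forall a, cat_comp (eta a) (eps a) = cat_id (G a)].

Definition equivalent (C D : category) :=
  exists (F : functor C D) (G : functor D C),
    naturally_isomorphic (functor_comp G F) (functor_id C) /\
    naturally_isomorphic (functor_comp F G) (functor_id D).

Definition contravariantly_equivalent (C D : category) :=
  equivalent (opposite C) D.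

Lemma sval_injP (T : Type) (P : T -> Prop) (u v : {x | P x}) :
  sval u = sval v -> u = v.
Proof. by case: u v => [x p] [y q] /= e; exact: eq_exist. Qed.

Section Categories.
Variables (Delta : finType) (Q : diffNzRingType Delta).

Record qr_dfg_alg := QrDfgAlg {
  qr_alg :> diffAlg Q;
  qr_algP : quasireduced qr_alg;
  qr_alg_fg : diff_fin_gen qr_alg
}.

Definition alg_hom (A B : diffAlg Q) := {f : A -> B | is_diff_alg_hom f}.

Fact alg_id_subproof (A : diffAlg Q) : is_diff_alg_hom (@id A).
Proof. by []. Qed.

Fact alg_comp_subproof (A B C : diffAlg Q) (g : alg_hom B C) (f : alg_hom A B) :
  is_diff_alg_hom (fun x => sval g (sval f x)).
Proof.
case: g f => [g [gD gM g1 gd gQ]] [f [fD fM f1 fd fQ]] /=.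
split=> [x y|x y||d x|c].
- by rewrite fD gD.
- by rewrite fM gM.
- by rewrite f1 g1.
- by rewrite fd gd.
- by rewrite fQ gQ.
Qed.

Definition alg_id (A : diffAlg Q) : alg_hom A A :=
  exist _ _ (alg_id_subproof A).

Definition alg_comp (A B C : diffAlg Q) (g : alg_hom B C) (f : alg_hom A B) :
  alg_hom A C := exist _ _ (alg_comp_subproof g f).

Fact alg_compm1 A B (f : alg_hom A B) : alg_comp f (alg_id A) = f.
Proof. exact: sval_injP. Qed.

Fact alg_comp1m A B (f : alg_hom A B) : alg_comp (alg_id B) f = f.
Proof. exact: sval_injP. Qed.

Fact alg_compA A B C D (h : alg_hom C D) (g : alg_hom B C) (f : alg_hom A B) :
  alg_comp h (alg_comp g f) = alg_comp (alg_comp h g) f.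
Proof. exact: sval_injP. Qed.

Definition algebras : category :=
  @Category qr_dfg_alg (fun A B => alg_hom A B) (fun A => alg_id A)
    (fun A B C => @alg_comp A B C) (fun A B => @alg_compm1 A B)
    (fun A B => @alg_comp1m A B) (fun A B C D => @alg_compA A B C D).

Record quasivariety := Quasivariety {
  qdim : nat;
  qset : set {ffun 'I_qdim -> Q};
  qsetP : exists E : set (dpoly Q qdim), qset = zeros E
}.

Definition points (X : quasivariety) := {x | @qset X x}.

Definition regular (X Y : quasivariety) (f : points X -> points Y) :=
  exists phi : 'I_(qdim Y) -> dpoly Q (qdim X),
    forall x, sval (f x) = [ffun j => deval idfun (sval x) (phi j)].

Definition regular_map (X Y : quasivariety) :=
  {f : points X -> points Y | regular f}.

Fact regular_id_subproof (X : quasivariety) : regular (@id (points X)).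
Proof.
exists (fun j => << ucm (mone, j) >>) => x; apply/ffunP => j; rewrite ffunE.
by apply: esym; apply: (etrans (devalX idfun _ _)); rewrite theta1.
Qed.

Fact regular_comp_subproof (X Y Z : quasivariety) (g : regular_map Y Z)
  (f : regular_map X Y) : regular (fun x => sval g (sval f x)).
Proof.
case: g f => [g [psi gE]] [f [phi fE]] /=.
exists (fun k => deval malgC phi (psi k)) => x; apply/ffunP => k.
rewrite gE !ffunE; apply: esym; apply: (etrans (deval_comp _ _ _)).
by congr (deval idfun _ (psi k)); apply/funext => j; rewrite fE ffunE.
Qed.

Definition regular_id (X : quasivariety) : regular_map X X :=
  exist _ _ (regular_id_subproof X).

Definition regular_comp (X Y Z : quasivariety) (g : regular_map Y Z)
    (f : regular_map X Y) : regular_map X Z :=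
  exist _ _ (regular_comp_subproof g f).

Fact regular_compm1 X Y (f : regular_map X Y) : regular_comp f (regular_id X) = f.
Proof. exact: sval_injP. Qed.

Fact regular_comp1m X Y (f : regular_map X Y) : regular_comp (regular_id Y) f = f.
Proof. exact: sval_injP. Qed.

Fact regular_compA X Y Z W (h : regular_map Z W) (g : regular_map Y Z)
    (f : regular_map X Y) :
  regular_comp h (regular_comp g f) = regular_comp (regular_comp h g) f.
Proof. exact: sval_injP. Qed.

Definition quasivarieties : category :=
  Category regular_compm1 regular_comp1m regular_compA.

End Categories.

(* Main.v *)
(* The functor sends a quasivariety X to its ring k[X] of polynomial functions.
   A homomorphism k[Y] -> k[X] is the pullback along the map X -> Q^m whose
   components represent the images of the coordinate functions; this map lands
   in Y because the equations of Y vanish in k[Y].  A quasireduced algebra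
   Q{y}/I has rad I = I, hence I = I(V(I)) as Q is differentially closed, so
   the algebra is k[V(I)].  That k[X] is quasireduced reduces pointwise to Q,
   where it is the case n = 0, I = 0 of rad I = I(V(I)). *)
Require Import Defs.
From HB Require Import structures.
From mathcomp Require Import all_boot all_algebra.
From mathcomp Require Import boolp classical_sets.
From mathcomp.multinomials Require Import monalg.

Set Implicit Arguments.
Unset Strict Implicit.
Unset Printing Implicit Defensive.

Import GRing.Theory.

Local Open Scope ring_scope.

(** * Equivalences of categories from fully faithful, essentially surjective functors *)

Lemma equivalent_sym (C D : category) : equivalent C D -> equivalent D C.
Proof. by move=> [F [G [h k]]]; exists G, F. Qed.

(** The quasi-inverse is obtained by choice: an object goes to a chosen preimage up to isomorphism,
    an arrow to the lift of its conjugate by the chosen isomorphisms. Faithfulness transfers every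
    identity to be checked in [C] to [D], where these isomorphisms cancel. *)
Lemma fully_faithful_equivalent (C D : category) (G : functor C D) :
  (forall a b (f g : Defs.hom a b), functor_hom G f = functor_hom G g -> f = g) ->
  (forall a b (g : Defs.hom (G a) (G b)), exists f, functor_hom G f = g) ->
  (forall d, exists c (u : Defs.hom (G c) d) (v : Defs.hom d (G c)),
     cat_comp u v = cat_id d /\ cat_comp v u = cat_id (G c)) ->
  equivalent C D.
Proof.
move=> faith full ess.
pose lift a b (g : Defs.hom (G a) (G b)) : Defs.hom a b := sval (cid (full a b g)).
have liftK a b g : functor_hom G (lift a b g) = g by rewrite /lift; case: cid.
pose F0 d : C := sval (cid (ess d)).
pose u d : Defs.hom (G (F0 d)) d := sval (cid (svalP (cid (ess d)))).
pose v d : Defs.hom d (G (F0 d)) := sval (cid (svalP (cid (svalP (cid (ess d)))))).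
have uv d : cat_comp (u d) (v d) = cat_id d.
  by have [] := svalP (cid (svalP (cid (svalP (cid (ess d)))))).
have vu d : cat_comp (v d) (u d) = cat_id (G (F0 d)).
  by have [] := svalP (cid (svalP (cid (svalP (cid (ess d)))))).
have vl d e (f : Defs.hom e d) : cat_comp (u d) (cat_comp (v d) f) = f.
  by rewrite cat_compA uv cat_comp1m.
pose F1 d e (f : Defs.hom d e) : Defs.hom (F0 d) (F0 e) :=
  lift _ _ (cat_comp (v e) (cat_comp f (u d))).
have F1_id d : F1 d d (cat_id d) = cat_id (F0 d).
  by apply: faith; rewrite liftK cat_comp1m vu functor_hom_id.
have F1_comp d e e' (g : Defs.hom e e') (f : Defs.hom d e) :
    F1 d e' (cat_comp g f) = cat_comp (F1 e e' g) (F1 d e f).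
  by apply: faith; rewrite functor_hom_comp !liftK -!cat_compA vl.
exists G, (Functor F1_id F1_comp); split.
  (* On the side of [C] the isomorphisms [u] and [v] live between images under [G], so their lifts
     serve as the components. *)
  exists (fun a => lift _ _ (u (G a))), (fun a => lift _ _ (v (G a))).
  split=> [a b f|a|a] /=; apply: faith;
    rewrite !functor_hom_comp ?functor_hom_id !liftK //.
exists u, v; split=> [d e f|d|d] /=; [|exact: vu|exact: uv].
by rewrite liftK vl.
Qed.

(** * Homomorphisms of differential algebras and the universal property of Q{y} *)

Lemma der0 (Delta : finType) (R : diffRingType Delta) d : der d 0 = 0 :> R.
Proof. by apply: (@addrI _ (der d 0)); rewrite -derD !addr0. Qed.

Section Homomorphisms.
Variables (Delta : finType) (Q : diffNzRingType Delta).

Section Theory.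
Variables (A B : diffAlg Q) (f : alg_hom A B).

Lemma alg_homD : {morph sval f : x y / x + y}.
Proof. by case: (svalP f). Qed.

Lemma alg_homM : {morph sval f : x y / x * y}.
Proof. by case: (svalP f). Qed.

Lemma alg_hom1 : sval f 1 = 1.
Proof. by case: (svalP f). Qed.

Lemma alg_hom_der d : {morph sval f : x / der d x}.
Proof. by case: (svalP f). Qed.

Lemma alg_hom_in c : sval f (alg_in A c) = alg_in B c.
Proof. by case: (svalP f). Qed.

Lemma alg_hom0 : sval f 0 = 0.
Proof. by apply: (@addrI _ (sval f 0)); rewrite -alg_homD !addr0. Qed.

Lemma alg_homB : {morph sval f : x y / x - y}.
Proof.
by move=> x y; apply: (@addIr _ (sval f y)); rewrite -alg_homD !subrK.
Qed.

Lemma alg_homX n : {morph sval f : x / x ^+ n}.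
Proof.
by move=> x; elim: n => [|n IH]; rewrite ?alg_hom1 // !exprS alg_homM IH.
Qed.

Lemma alg_hom_theta t : {morph sval f : x / theta t x}.
Proof. by move=> x; apply: theta_morph; exact: alg_hom_der. Qed.

End Theory.

Lemma alg_homP (A B : diffAlg Q) (f g : alg_hom A B) :
  (forall x, sval f x = sval g x) -> f = g.
Proof. by move=> fg; apply: sval_injP; apply: funext. Qed.

Fact idfun_der d : {morph (idfun : {rmorphism Q -> Q}) : c / der d c}.
Proof. by []. Qed.

Definition base_alg : diffAlg Q := DiffAlg idfun_der.

Fact malgC_der n d :
  {morph (malgC : {rmorphism Q -> dpoly Q n}) : c / der d c}.
Proof. by move=> c; apply: esym; exact: der_malgC (derD d) c. Qed.

Definition dpoly_alg n : diffAlg Q := DiffAlg (@malgC_der n).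

Definition var n (i : 'I_n) : dpoly_alg n := (<< ucm (mone, i) >> : dpoly Q n).

Lemma theta_var n t (i : 'I_n) : theta t (var i) = (<< ucm (t, i) >> : dpoly Q n).
Proof.
elim/monom_ind: t => [|d t IH]; first exact: theta1.
rewrite theta_der IH; exact (der_malgX (shift_var d) (derD d) (derM d) (t, i)).
Qed.

(** Every indeterminate is a derivative of some [var i] by [theta_var], so the [var i] generate Q{y}
    differentially. This is the uniqueness half of the universal property. *)
Lemma dpoly_alg_hom_inj n (A : diffAlg Q) (f g : alg_hom (dpoly_alg n) A) :
  (forall i, sval f (var i) = sval g (var i)) -> f = g.
Proof.
move=> fg; apply: alg_homP; apply: malg_gen_ind => [c|[t i]|p q hp hq|p q hp hq].
- exact: etrans (alg_hom_in f c) (esym (alg_hom_in g c)).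
- rewrite -theta_var.
  apply: etrans (alg_hom_theta f t _) _; rewrite fg.
  exact: esym (alg_hom_theta g t _).
- apply: etrans (alg_homD f p q) _; rewrite hp hq.
  exact: esym (alg_homD g p q).
- apply: etrans (alg_homM f p q) _; rewrite hp hq.
  exact: esym (alg_homM g p q).
Qed.

Lemma deval_alg_hom n (S : diffNzRingType Delta) (f : {rmorphism Q -> S})
    (fd : forall d, {morph f : c / der d c}) (b : 'I_n -> S) :
  is_diff_alg_hom (deval f b : dpoly_alg n -> DiffAlg fd).
Proof.
split; [exact: devalD | exact: devalM | | exact: deval_der | exact: devalC].
exact: etrans (devalC f b 1) (rmorph1 f).
Qed.

Lemma deval_var n (S : diffNzRingType Delta) (f : {rmorphism Q -> S})
  (b : 'I_n -> S) i : deval f b (var i) = b i.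
Proof. by apply: etrans (devalX f b _) _; exact: theta1. Qed.

(* [deval] requires a nonzero target, hence the two cases. *)
Lemma ex_dpoly_alg_hom (A : diffAlg Q) n (b : 'I_n -> A) :
  exists f : alg_hom (dpoly_alg n) A, forall i, sval f (var i) = b i.
Proof.
have [A0|A1] := eqVneq (1 : A) 0.
  have AE (x y : A) : x = y by rewrite -[x]mulr1 -[y]mulr1 A0 !mulr0.
  have f_hom : is_diff_alg_hom (fun _ : dpoly_alg n => 0 : A).
    by split=> [x y|x y||d x|c]; exact: AE.
  by exists (exist _ _ f_hom) => i; exact: AE.
(* [S] has the carrier and operations of [A], so a homomorphism into [S] is by conversion one into
   [A]. *)
pose S : diffNzRingType Delta :=
  HB.pack (DiffRing.sort A) (GRing.PzSemiRing_isNonZero.Build A A1).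
pose f : {rmorphism Q -> S} := alg_in A.
have fd d : {morph f : c / der d c} by exact: alg_in_der.
exists (exist _ (deval f b) (deval_alg_hom fd b)) => i.
exact: (deval_var f b i).
Qed.

Definition eval_hom n (x : 'I_n -> Q) : alg_hom (dpoly_alg n) base_alg :=
  exist _ _ (deval_alg_hom idfun_der x).

(** The homomorphism theorem, with [A] in the role of P / ker e. Composing [r] with a set-theoretic
    section of [e] gives a homomorphism because two preimages of one element differ by an element of
    ker e, which [r] kills. *)
Lemma alg_hom_lift (P A B : diffAlg Q) (e : alg_hom P A) (r : alg_hom P B) :
  (forall a, exists p, sval e p = a) ->
  (forall p, sval e p = 0 -> sval r p = 0) ->
  exists g : alg_hom A B, forall p, sval g (sval e p) = sval r p.
Proof.
move=> e_surj er; pose s a := sval (cid (e_surj a)).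
have sK a : sval e (s a) = a := svalP (cid (e_surj a)).
have gE p : sval r (s (sval e p)) = sval r p.
  by apply/subr0_eq; rewrite -alg_homB er // alg_homB sK subrr.
have g_hom : is_diff_alg_hom (fun a => sval r (s a)).
  split=> [x y|x y||d x|c].
  - by rewrite -{1}[x]sK -{1}[y]sK -alg_homD gE alg_homD.
  - by rewrite -{1}[x]sK -{1}[y]sK -alg_homM gE alg_homM.
  - by rewrite -(alg_hom1 e) gE alg_hom1.
  - by rewrite -{1}[x]sK -alg_hom_der gE alg_hom_der.
  - by rewrite -(alg_hom_in e) gE alg_hom_in.
by exists (exist _ _ g_hom).
Qed.

End Homomorphisms.

(** * The differential algebra of polynomial functions on a quasivariety *)

Section CoordinateRing.
Variables (Delta : finType) (Q : diffNzRingType Delta) (X : quasivariety Q).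

(** This models Q{y} / I(X) without a quotient. The representing polynomial is only asserted to
    exist, so equality is equality of values and all algebraic laws are inherited pointwise from
    [Q]. *)
Record coord_ring := CoordRing {
  coord_fun :> points X -> Q;
  coord_funP : exists p : dpoly Q (qdim X),
    forall x, coord_fun x = deval idfun (sval x) p
}.

Lemma coord_ringP (f g : coord_ring) : (forall x, f x = g x) -> f = g.
Proof.
case: f g => [f fP] [g gP] /= /funext fg.
by case: _ / fg gP => gP; congr CoordRing; exact: Prop_irrelevance.
Qed.

HB.instance Definition _ := gen_eqMixin coord_ring.
HB.instance Definition _ := gen_choiceMixin coord_ring.

Definition restrict (p : dpoly Q (qdim X)) : coord_ring :=
  @CoordRing (fun x => deval idfun (sval x) p) (ex_intro _ p (fun=> erefl)).

Lemma restrict_surj f : exists p, restrict p = f.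
Proof. by have [p fp] := coord_funP f; exists p; apply: coord_ringP => x /=. Qed.

Fact coord_const_subproof c :
  exists p : dpoly Q (qdim X), forall x : points X, c = deval idfun (sval x) p.
Proof. by exists c%:MP => x; exact: esym (devalC idfun _ c). Qed.

Definition coord_const c : coord_ring := CoordRing (coord_const_subproof c).

Fact coord_add_subproof (f g : coord_ring) :
  exists p : dpoly Q (qdim X), forall x, f x + g x = deval idfun (sval x) p.
Proof.
have [p fp] := coord_funP f; have [q gq] := coord_funP g.
by exists (p + q) => x; rewrite fp gq; exact: esym (devalD idfun _ p q).
Qed.

Definition coord_add f g : coord_ring := CoordRing (coord_add_subproof f g).

Fact coord_mul_subproof (f g : coord_ring) :
  exists p : dpoly Q (qdim X), forall x, f x * g x = deval idfun (sval x) p.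
Proof.
have [p fp] := coord_funP f; have [q gq] := coord_funP g.
by exists (p * q) => x; rewrite fp gq; exact: esym (devalM idfun _ p q).
Qed.

Definition coord_mul f g : coord_ring := CoordRing (coord_mul_subproof f g).

Fact coord_opp_subproof (f : coord_ring) :
  exists p : dpoly Q (qdim X), forall x, - f x = deval idfun (sval x) p.
Proof.
have [p fp] := coord_funP (coord_mul (coord_const (- 1)) f).
by exists p => x; rewrite -fp /= mulN1r.
Qed.

Definition coord_opp f : coord_ring := CoordRing (coord_opp_subproof f).

(** The derivation acts on values. It preserves polynomial functions because evaluation at a point
    commutes with the derivations. *)
Fact coord_der_subproof d (f : coord_ring) :
  exists p : dpoly Q (qdim X), forall x, der d (f x) = deval idfun (sval x) p.
Proof.
have [p fp] := coord_funP f; exists (der d p) => x; rewrite fp.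
exact: esym (alg_hom_der (eval_hom (sval x)) d p).
Qed.

Definition coord_der d f : coord_ring := CoordRing (coord_der_subproof d f).

Fact coord_addA : associative coord_add.
Proof. by move=> f g h; apply: coord_ringP => x; exact: addrA. Qed.

Fact coord_addC : commutative coord_add.
Proof. by move=> f g; apply: coord_ringP => x; exact: addrC. Qed.

Fact coord_add0 : left_id (coord_const 0) coord_add.
Proof. by move=> f; apply: coord_ringP => x; exact: add0r. Qed.

Fact coord_addN : left_inverse (coord_const 0) coord_opp coord_add.
Proof. by move=> f; apply: coord_ringP => x; exact: addNr. Qed.

HB.instance Definition _ := GRing.isZmodule.Build coord_ring
  coord_addA coord_addC coord_add0 coord_addN.

Fact coord_mulA : associative coord_mul.
Proof. by move=> f g h; apply: coord_ringP => x; exact: mulrA. Qed.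

Fact coord_mulC : commutative coord_mul.
Proof. by move=> f g; apply: coord_ringP => x; exact: mulrC. Qed.

Fact coord_mul1 : left_id (coord_const 1) coord_mul.
Proof. by move=> f; apply: coord_ringP => x; exact: mul1r. Qed.

Fact coord_mulD : left_distributive coord_mul +%R.
Proof. by move=> f g h; apply: coord_ringP => x; exact: mulrDl. Qed.

HB.instance Definition _ := GRing.Zmodule_isComPzRing.Build coord_ring
  coord_mulA coord_mulC coord_mul1 coord_mulD.

Fact coord_derD d : {morph coord_der d : f g / f + g}.
Proof. by move=> f g; apply: coord_ringP => x; exact: derD. Qed.

Fact coord_derM d f g : coord_der d (f * g) = coord_der d f * g + f * coord_der d g.
Proof. by apply: coord_ringP => x; exact: derM. Qed.

Fact coord_derC d e f : coord_der d (coord_der e f) = coord_der e (coord_der d f).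
Proof. by apply: coord_ringP => x; exact: derC. Qed.

HB.instance Definition _ :=
  isDifferential.Build Delta coord_ring coord_derD coord_derM coord_derC.

Fact coord_const_zmod_morphism : zmod_morphism coord_const.
Proof. by move=> c c'; apply: coord_ringP. Qed.

Fact coord_const_monoid_morphism : monoid_morphism coord_const.
Proof. by split=> [|c c']; apply: coord_ringP. Qed.

HB.instance Definition _ :=
  GRing.isZmodMorphism.Build Q coord_ring coord_const coord_const_zmod_morphism.
HB.instance Definition _ :=
  GRing.isMonoidMorphism.Build Q coord_ring coord_const coord_const_monoid_morphism.

Fact coord_const_der d : {morph coord_const : c / der d c}.
Proof. by move=> c; apply: coord_ringP. Qed.

Definition coord_alg : diffAlg Q := DiffAlg coord_const_der.

Fact restrict_alg_hom : is_diff_alg_hom (restrict : dpoly_alg Q (qdim X) -> coord_alg).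
Proof.
split=> [p q|p q||d p|c]; apply: coord_ringP => x.
- exact: (alg_homD (eval_hom (sval x))).
- exact: (alg_homM (eval_hom (sval x))).
- exact: (alg_hom1 (eval_hom (sval x))).
- exact: (alg_hom_der (eval_hom (sval x))).
- exact: (alg_hom_in (eval_hom (sval x))).
Qed.

Definition restrict_hom : alg_hom (dpoly_alg Q (qdim X)) coord_alg :=
  exist _ _ restrict_alg_hom.

Fact point_alg_hom (x : points X) :
  is_diff_alg_hom ((fun f => coord_fun f x) : coord_alg -> base_alg Q).
Proof. by []. Qed.

Definition point_hom x : alg_hom coord_alg (base_alg Q) :=
  exist _ _ (point_alg_hom x).

Lemma coord_alg_quasireduced : quasireduced Q -> quasireduced coord_alg.
Proof.
move=> Qqr f fnil; apply: coord_ringP => x.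
apply: Qqr => t; have [k fk] := fnil t; exists k.
(* Evaluation at [x] is a differential homomorphism, so it carries nilpotency of [theta t f] to
   [theta t (f x)]. *)
have := congr1 (sval (point_hom x)) fk.
by rewrite alg_homX alg_hom_theta alg_hom0.
Qed.

Lemma coord_alg_fin_gen : diff_fin_gen coord_alg.
Proof.
exists (qdim X), (fun i => restrict (var Q i)) => S [SC SD SM] Sgen.
apply/seteqP; split=> // f _; have [p <-] := restrict_surj f.
elim/malg_gen_ind: p => [c|[t i]|p q Sp Sq|p q Sp Sq].
- by have := SC c; rewrite -(alg_hom_in restrict_hom c).
- by have := Sgen t i; rewrite -(alg_hom_theta restrict_hom t (var Q i)) theta_var.
- by have := SD _ _ Sp Sq; rewrite -(alg_homD restrict_hom p q).
- by have := SM _ _ Sp Sq; rewrite -(alg_homM restrict_hom p q).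
Qed.

End CoordinateRing.

(** * The coordinate ring functor over a differentially closed Q *)

Section Equivalence.
Variables (Delta : finType) (Q : diffNzRingType Delta).
Hypothesis Qcl : diff_closed Q.

Lemma diff_closed_quasireduced : quasireduced Q.
Proof.
move=> c cnil; have I0 : diff_ideal [set (0 : dpoly Q 0)]%classic.
  split=> [|x y -> ->|a x ->|d x ->] //=; rewrite ?addr0 ?mulr0 //.
  exact: der0.
have : Defs.rad [set (0 : dpoly Q 0)]%classic c%:MP.
  move=> t; have [k ck] := cnil t; exists k => /=.
  rewrite -[c%:MP]/(alg_in (dpoly_alg Q 0) c).
  rewrite -[LHS](_ : alg_in (dpoly_alg Q 0) (theta t c ^+ k) = _).
    by rewrite ck; exact: rmorph0.
  rewrite rmorphXn; congr (_ ^+ k); exact: theta_morph (@malgC_der _ Q 0) t c.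
(* [[ffun=> 0]] is the only point of Q^0. It is a zero of the zero ideal, and the constant
   polynomial takes the value [c] there. *)
rewrite (Qcl I0) => /(_ [ffun=> 0]) <- //; first exact: esym (devalC idfun _ c).
by move=> _ ->; exact: (alg_hom0 (eval_hom [ffun=> 0])).
Qed.

Definition coord_qr_dfg_alg (X : quasivariety Q) : qr_dfg_alg Q :=
  QrDfgAlg (coord_alg_quasireduced diff_closed_quasireduced)
           (@coord_alg_fin_gen _ _ X).

(** * Pullback along regular maps and its full faithfulness *)

Section Pullback.
Variables (X Y : quasivariety Q) (f : regular_map X Y).

Fact pullback_subproof (g : coord_ring Y) :
  exists p : dpoly Q (qdim X), forall x, g (sval f x) = deval idfun (sval x) p.
Proof.
have [p gp] := coord_funP g; have [phi fphi] := svalP f.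
(* This is [p] with the components [phi] of the regular map substituted for its variables. *)
exists (deval malgC phi p) => x; rewrite gp fphi deval_comp.
by congr (deval idfun _ p); apply/funext => j; rewrite ffunE.
Qed.

Definition pullback_fun g : coord_ring X := CoordRing (pullback_subproof g).

Fact pullback_alg_hom :
  is_diff_alg_hom (pullback_fun : coord_alg Y -> coord_alg X).
Proof. by split=> [g h|g h||d g|c]; apply: coord_ringP. Qed.

Definition pullback : alg_hom (coord_alg Y) (coord_alg X) :=
  exist _ _ pullback_alg_hom.

End Pullback.

Fact pullback_id (X : quasivariety Q) :
  pullback (regular_id X) = alg_id (coord_alg X).
Proof. by apply: alg_homP => g; apply: coord_ringP. Qed.

Fact pullback_comp (X Y Z : quasivariety Q) (g : regular_map Y Z)
    (f : regular_map X Y) :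
  pullback (regular_comp g f) = alg_comp (pullback f) (pullback g).
Proof. by apply: alg_homP => h; apply: coord_ringP. Qed.

(** With the opposite category as target, pullback becomes covariant and the general criterion for
    equivalences applies. *)
Definition coord_functor : functor (quasivarieties Q) (opposite (algebras Q)) :=
  @Functor (quasivarieties Q) (opposite (algebras Q)) coord_qr_dfg_alg
    pullback pullback_id pullback_comp.

(** The j-th coordinate of [f x] is the value at [x] of the pullback of the j-th coordinate
    function. *)
Lemma pullback_inj (X Y : quasivariety Q) (f g : regular_map X Y) :
  pullback f = pullback g -> f = g.
Proof.
move=> fg; apply: sval_injP; apply/funext => x; apply: sval_injP.
apply/ffunP => j; have := congr1 (fun h : alg_hom (coord_alg Y) (coord_alg X) =>
  sval (point_hom x) (sval h (restrict (var Q j)))) fg.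
by rewrite /= !deval_var.
Qed.

Lemma pullback_surj (X Y : quasivariety Q)
  (h : alg_hom (coord_alg Y) (coord_alg X)) : exists f, pullback f = h.
Proof.
pose phi j := sval (cid (restrict_surj (sval h (restrict (var Q j))))).
have phiE j : restrict (phi j) = sval h (restrict (var Q j)).
  exact: svalP (cid (restrict_surj _)).
pose F (x : points X) : {ffun 'I_(qdim Y) -> Q} :=
  [ffun j => deval idfun (sval x) (phi j)].
(* Both sides are homomorphisms from Q{y} to [Q], so it suffices to compare them on the
   variables. *)
have hE x : alg_comp (point_hom x) (alg_comp h (restrict_hom Y)) = eval_hom (F x).
  apply: dpoly_alg_hom_inj => j /=.
  by rewrite deval_var ffunE -[RHS]/(restrict (phi j) x) phiE.
have FY x : qset (F x).
  have [E YE] := qsetP Y; rewrite YE => p Ep.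
  have := congr1 (fun k => sval k p) (hE x) => /= <-.
  (* An equation of [Y] is zero as a function on [Y]; by [hE], its value at [F x] is then the image
     of 0 under a homomorphism. *)
  have -> : restrict p = 0.
    apply: coord_ringP => -[y Yy]; have : zeros E y by rewrite -YE.
    exact.
  exact: (alg_hom0 (alg_comp (point_hom x) h)).
have f_reg : regular (fun x => exist _ (F x) (FY x) : points Y) by exists phi.
exists (exist _ _ f_reg); apply: alg_homP => g; apply: coord_ringP => x.
have [p <-] := restrict_surj g.
exact: esym (congr1 (fun k => sval k p) (hE x)).
Qed.

(** * Essential surjectivity: quasireduced algebras as coordinate rings *)

Section Presentation.
Variables (A : diffAlg Q) (n : nat) (e : alg_hom (dpoly_alg Q n) A).
Hypotheses (A_qr : quasireduced A) (e_surj : forall a, exists p, sval e p = a).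

Let ker : set (dpoly Q n) := [set p | sval e p = 0]%classic.

Lemma ker_diff_ideal : diff_ideal ker.
Proof.
split=> [|p q /= hp hq|p q /= hq|d p /= hp].
- exact: (alg_hom0 e).
- by apply: etrans (alg_homD e p q) _; rewrite hp hq addr0.
- by apply: etrans (alg_homM e p q) _; rewrite hq mulr0.
- by apply: etrans (alg_hom_der e d p) _; rewrite hp der0.
Qed.

Lemma vanishing_ker : vanishing (zeros ker) = ker.
Proof.
apply/seteqP; split=> p hp; last by move=> x; apply.
move: hp; rewrite -(Qcl ker_diff_ideal) => hp.
(* A power of [theta t p] lying in [ker] says that [theta t (sval e p)] is nilpotent, so
   quasireducedness of [A] forces [p] into [ker]. *)
apply: A_qr => t; have [k hk] := hp t; exists k.
by rewrite -(alg_hom_theta e) -(alg_homX e).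
Qed.

(** [A] and the coordinate ring of V(ker) are both images of Q{y}. Their kernels agree, so each
    surjection factors through the other, and the two factorizations are mutually inverse. *)
Lemma ex_spectrum : exists (X : quasivariety Q)
    (u : alg_hom A (coord_alg X)) (v : alg_hom (coord_alg X) A),
  alg_comp v u = alg_id A /\ alg_comp u v = alg_id (coord_alg X).
Proof.
pose X := Quasivariety (ex_intro (fun E => zeros ker = zeros E) ker erefl).
have [u uE] : exists u : alg_hom A (coord_alg X),
    forall p, sval u (sval e p) = sval (restrict_hom X) p.
  apply: alg_hom_lift => // p ep; apply: coord_ringP => x.
  exact: (svalP x).
have [v vE] : exists v : alg_hom (coord_alg X) A,
    forall p, sval v (sval (restrict_hom X) p) = sval e p.
  apply: alg_hom_lift => [|p rp]; first exact: restrict_surj.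
  (* This inclusion of kernels is where differential closedness enters; the opposite one holds by
     definition of [X]. *)
  suff : ker p by []; rewrite -vanishing_ker => x hx.
  exact: (congr1 (fun f : coord_ring X => f (exist _ x hx)) rp).
exists X, u, v; split; apply: alg_homP => a.
  by have [p <-] := e_surj a; rewrite /= uE vE.
by have [p <-] := restrict_surj a; rewrite /= vE uE.
Qed.

End Presentation.

Lemma diff_fin_gen_presentation (A : diffAlg Q) : diff_fin_gen A ->
  exists n (e : alg_hom (dpoly_alg Q n) A), forall a, exists p, sval e p = a.
Proof.
move=> [n [b bgen]]; have [e eb] := ex_dpoly_alg_hom b; exists n, e.
(* The range of [e] is a subalgebra containing all derivatives of the generators, hence
   everything. *)
have e_range : [set a | exists p, sval e p = a]%classic = setT.
  apply: bgen => [|t i]; last by exists (theta t (var Q i)); rewrite alg_hom_theta eb.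
  split=> [c|_ _ [p <-] [q <-]|_ _ [p <-] [q <-]].
  - by exists (alg_in (dpoly_alg Q n) c); exact: alg_hom_in.
  - by exists (p + q); exact: (alg_homD e).
  - by exists (p * q); exact: (alg_homM e).
by move=> a; have : [set: A]%classic a by []; rewrite -e_range.
Qed.

Lemma coord_functor_equivalence :
  equivalent (quasivarieties Q) (opposite (algebras Q)).
Proof.
apply: (@fully_faithful_equivalent _ _ coord_functor).
- exact: pullback_inj.
- exact: pullback_surj.
- move=> A; have [n [e e_surj]] := diff_fin_gen_presentation (qr_alg_fg A).
  (* In the opposite category [u] is an arrow from the coordinate ring to [A], and composites are
     read in reverse, so [vu] and [uv] are the required identities. *)
  have [X [u [v [vu uv]]]] := ex_spectrum (@qr_algP _ _ A) e_surj.
  by exists X, u, v.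
Qed.

End Equivalence.

Theorem theorem27 (Delta : finType) (Q : diffNzRingType Delta)
    (hQ : quasifield Q) (hcl : diff_closed Q) :
  contravariantly_equivalent (algebras Q) (quasivarieties Q).
Proof. exact/equivalent_sym/coord_functor_equivalence. Qed.
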